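(* The Maxwell-Boltzmann arrangement is multinomial: for every probability measure $\mu$ with all moments $\mu_n$ finite (so $\mu_0=1$), every $k\in\mathbf{N}$ and every integer $n\ge1$, the Maxwell-Boltzmann moment $\mu^{\circ k}_n$ satisfies $$\mu^{\circ k}_n=\sum_{n_1+\cdots+n_k=n}\frac{n!}{n_1!\cdots n_k!}\prod_{i=1}^k\mu_{n_i},$$ the sum being over $k$-tuples of non-negative integers.
   Context: Given $\mu$ and $k\in\mathbf{N}$, the Maxwell-Boltzmann $\mu^{\circ k}_n$ is defined as $$\mu^{\circ k}_n=\sum_{j=1}^{k}\binom{k}{j}\sum_{n_1=1}^{n}\cdots\sum_{n_j=1}^{n}\chi_{(n_1+\cdots+n_j=n)}\frac{n!}{n_1!\cdots n_j!}\prod_{i=1}^{j}\mu_{n_i},$$ where $\chi_{(n_1+\cdots+n_j=n)}$ equals $1$ if $n_1+\cdots+n_j=n$ and $0$ otherwise. A combinatorial composition with moments $\sum_{n_1+\dots+n_k=n}(n;n_1,\dots,n_k)\prod_{i=1}^k\mu_{n_i}$ is called multinomial if $(n;n_1,\dots,n_k)=\frac{n!}{n_1!\cdots n_k!}$. *)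

(* Defs.v *)
From HB Require Import structures.
From mathcomp Require Export all_boot all_order all_algebra.
From mathcomp Require Export all_classical all_reals all_analysis.
Export Order.TTheory GRing.Theory Num.Theory.
Export numFieldNormedType.Exports.

Set Implicit Arguments.
Unset Strict Implicit.
Unset Printing Implicit Defensive.

Local Open Scope ring_scope.

Definition finite_moments (R : realType)
    (mu : probability (measurableTypeR R) R) : Prop :=
  forall n : nat, mu.-integrable setT (fun x : R => (x ^+ n)%:E).

Definition moment (R : realType)
    (mu : probability (measurableTypeR R) R) (n : nat) : R :=
  \int[mu]_x (x ^+ n).

Definition multinomial_coef (R : realType) (n j : nat)
    (t : {ffun 'I_j -> 'I_n.+1}) : R :=
  n`!%:R / \prod_(i < j) (t i)`!%:R.

(* The iterated sum over n_1, ..., n_j, each ranging from 1 to n, is a single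
   sum over the finite functions t : i |-> n_i with values in {1, ..., n}. *)
Definition maxwell_boltzmann_moment (R : realType)
    (mu : probability (measurableTypeR R) R) (k n : nat) : R :=
  \sum_(1 <= j < k.+1) 'C(k, j)%:R *
    \sum_(t : {ffun 'I_j -> 'I_n.+1} | [forall i, (1 <= t i)%N])
      ((\sum_(i < j) t i)%N == n)%:R * multinomial_coef R t *
      \prod_(i < j) moment mu (t i).

(* Main.v *)
(* Expanding powers of a polynomial identifies the right-hand side, divided by
   n!, with the coefficient of X^n in P^k, where P is the exponential generating
   polynomial of the moments, and the inner sums on the left-hand side with the
   coefficients of X^n in (P - 1)^j.  As mu_0 = 1 the polynomial P - 1 is the
   part of P of positive degree, so the identity is the binomial theorem for
   (1 + (P - 1))^k; its term j = 0 contributes nothing because n >= 1. *)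
Require Import Defs.

Local Open Scope ring_scope.

Lemma moment0 (R : realType) (mu : probability (measurableTypeR R) R) :
  moment mu 0 = 1.
Proof.
rewrite /moment; under eq_Rintegral do rewrite expr0.
rewrite Rintegral_cst // mul1r; exact: (congr1 fine (probability_setT mu)).
Qed.

(** Distributivity gives one term per choice [t] of a summand in each of the [j] factors, a multiple
    of the monomial of degree [\sum_(i < j) t i]. *)
Lemma coef_exp_sum (R : comNzRingType) (m j n : nat) (p : pred 'I_m)
    (a : 'I_m -> R) :
  ((\sum_(i | p i) a i *: 'X^i) ^+ j)`_n =
  \sum_(t : {ffun 'I_j -> 'I_m} | [forall i, p (t i)])
    ((\sum_(i < j) t i)%N == n)%:R * \prod_(i < j) a (t i).
Proof.
rewrite -[in LHS](card_ord j) -prodr_const bigA_distr_big coef_sum.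
apply: eq_big => [t|t _]; first exact/ffun_onP/forallP.
by rewrite scaler_prod -expr_sum coefZ coefXn eq_sym mulrC.
Qed.

(** For [a] the moments, the factors on the right are coefficients of the exponential generating
    polynomial. *)
Lemma multinomial_coefE (R : realType) (n j : nat) (t : {ffun 'I_j -> 'I_n.+1})
    (a : nat -> R) :
  multinomial_coef R t * \prod_(i < j) a (t i) =
  n`!%:R * \prod_(i < j) (a (t i) / (t i)`!%:R).
Proof. by rewrite big_split prodfV /multinomial_coef -mulrA [_^-1 * _]mulrC. Qed.

(* A summand of n is at most n, so the k-tuples of non-negative integers with
   sum n are exactly those with values in 'I_n.+1 and sum n. *)
Theorem proposition2p3 (R : realType)
    (mu : probability (measurableTypeR R) R) (mu_fin : finite_moments mu)
    (k n : nat) (n_ge1 : (1 <= n)%N) :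
  maxwell_boltzmann_moment mu k n =
  \sum_(t : {ffun 'I_k -> 'I_n.+1} | (\sum_(i < k) t i)%N == n)
    multinomial_coef R t * \prod_(i < k) moment mu (t i).
Proof.
pose a (i : 'I_n.+1) : R := moment mu i / i`!%:R.
pose Q : {poly R} := \sum_(i : 'I_n.+1 | (1 <= i)%N) a i *: 'X^i.
have PE : \sum_(i : 'I_n.+1) a i *: 'X^i = 1 + Q.
  rewrite (bigD1 ord0) //= /a moment0 fact0 divr1 scale1r expr0; congr (_ + _).
  by apply: eq_bigl => i; rewrite lt0n.
transitivity (n`!%:R * ((1 + Q) ^+ k)`_n); last first.
  rewrite -PE coef_exp_sum mulr_sumr [RHS]big_mkcond.
  apply: eq_big => [t|t _]; first exact/forallP.
  by case: eqP => _; rewrite ?mul0r ?mulr0 // mul1r multinomial_coefE.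
(* Reindexing the binomial sum by natural numbers lets [big_ltn] detach the term [j = 0]. *)
rewrite exprDn coef_sum -(big_mkord xpredT
  (fun j => (1 ^+ (k - j) * Q ^+ j *+ 'C(k, j))`_n)) big_ltn //.
rewrite expr1n expr0 mul1r bin0 mulr1n coef1 gtn_eqF // add0r mulr_sumr.
apply: eq_bigr => j _; rewrite expr1n mul1r coefMn coef_exp_sum.
rewrite mulrnAr -[RHS]mulr_natl; congr (_ * _); rewrite mulr_sumr.
by apply: eq_bigr => t _; rewrite -mulrA multinomial_coefE mulrCA.
Qed.
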